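(* Let $n$ be a positive integer which is not a perfect square and let $(a,b)\in\mathbb{Z}^2$ be a solution of the Pell equation $x^2-ny^2=1$. Let $P,Q,D\in\mathbb{Z}[X]$ be polynomials with $\deg(P)=1$ and $\deg(D)=2$. Set $c=1$ if $b$ is odd and $c=2$ if $b$ is even. The following conditions are equivalent: (1) $P^2-DQ^2=1$, with $P(0)=a$, $Q(0)=b$ and $D(0)=n$. (2) There exists an integer $m\neq 0$ such that $P=P_0(c^{-1}mX)$, $Q=b$ and $D=D_0(c^{-1}mX)$, where \[P_0=b^2X+a,\qquad D_0=b^2X^2+2aX+n.\] *)

(* Defs.v *)
From mathcomp Require Import all_boot all_order all_algebra.
Set Implicit Arguments.
Unset Strict Implicit.
Unset Printing Implicit Defensive.
Import GRing.Theory Num.Theory.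
Local Open Scope ring_scope.

Definition perfect_square (n : int) : Prop := exists k : int, n = k ^+ 2.

Definition pell_c (b : int) : int := if (2 %| b)%Z then 2 else 1.

Definition pell_P0 (a b : int) : {poly int} := b ^+ 2 *: 'X + a%:P.

Definition pell_D0 (n a b : int) : {poly int} :=
  b ^+ 2 *: 'X^2 + (2 * a) *: 'X + n%:P.

(* As c may be 2, substitutions X |-> c^-1 m X take place in Q[X], into which
   Z[X] is embedded coefficientwise. *)
Definition ratp (p : {poly int}) : {poly rat} := map_poly intr p.

Definition dilate (t : rat) (p : {poly rat}) : {poly rat} := p \Po (t *: 'X).

(* Main.v *)
Require Import Defs.
From mathcomp Require Import all_boot all_order all_algebra.
From mathcomp Require Import ring lra zify.
Set Implicit Arguments.
Unset Strict Implicit.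
Unset Printing Implicit Defensive.
Import GRing.Theory Num.Theory.
Local Open Scope ring_scope.

(** The dilated pair satisfies the Pell equation identically, because
    (b^2 Y + a)^2 - (b^2 Y^2 + 2 a Y + n) b^2 = a^2 - n b^2 = 1 for every Y;
    this gives (2) => (1) after descending from Q[X] to Z[X].

    Conversely, since P^2 and D have the same degree, Q is a nonzero
    constant, namely b.  Writing P = p X + a and D = d X^2 + e X + n, the
    polynomial Pell equation amounts to p^2 = b^2 d and 2 a p = b^2 e.  As a is invertible
    modulo b^2 by the numerical Pell equation, b^2 divides 2 p, say
    2 p = b^2 k; then e = a k and 4 d = b^2 k^2, which says exactly that P and
    D are the dilations of P0 and D0 by k / 2 ([pell_coef_param]).  If b is
    even, m = k has k / 2 = m / c; if b is odd, 4 d = b^2 k^2 forces k to be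
    even, and m = k / 2 does ([half_pell_c]). *)

Lemma size2_poly (R : nzRingType) (P : {poly R}) :
  size P = 2%N -> P = P`_1 *: 'X + P.[0]%:P.
Proof.
move=> sP; apply/polyP=> i; rewrite horner_coef0 !coefE.
by case: i => [|[|i]]; rewrite /= ?mulr0 ?add0r ?mulr1 ?addr0 // nth_default ?sP.
Qed.

Lemma size3_poly (R : nzRingType) (D : {poly R}) :
  size D = 3%N -> D = D`_2 *: 'X^2 + D`_1 *: 'X + D.[0]%:P.
Proof.
move=> sD; apply/polyP=> i; rewrite horner_coef0 !coefE.
by case: i => [|[|[|i]]]; rewrite /= ?mulr0 ?add0r ?mulr1 ?addr0 ?add0r //
  nth_default ?sD.
Qed.

(** Comparing degrees in D Q^2 = P^2 - 1 leaves no room for a nonconstant Q. *)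
Lemma pell_const (R : idomainType) (P Q D : {poly R}) :
  size P = 2%N -> size D = 3%N -> P ^+ 2 - D * Q ^+ 2 = 1 ->
  Q != 0 /\ Q = Q.[0]%:P.
Proof.
move=> sP sD E.
have sP2 : size (P ^+ 2) = 3%N.
  have := size_exp P 2; rewrite sP mul1n.
  by case: (size (P ^+ 2)) => [|k] //= ->.
have sDQ : size (D * Q ^+ 2) = 3%N.
  have -> : D * Q ^+ 2 = P ^+ 2 - 1 by rewrite -E; ring.
  by rewrite size_polyDl // size_polyN size_poly1 sP2.
have Q0 : Q != 0.
  by apply/eqP => Q0; move: sDQ; rewrite Q0 expr0n mulr0 size_poly0.
have D0 : D != 0 by rewrite -size_poly_eq0 sD.
split=> //; have := size_exp Q 2.
have := size_mul D0 (expf_neq0 2 Q0); rewrite sDQ sD.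
move: (size (Q ^+ 2)) => [|[|s]] //= _ /esym/eqP; rewrite muln_eq0 orbF => sQ.
by rewrite horner_coef0; apply: size1_polyC; rewrite -subn_eq0 subn1.
Qed.

(** The congruence a^2 = 1 mod b^2 turns 2 a p = e b^2 into b^2 | 2 p, with
    cofactor a e - 2 n p. *)
Lemma pell_coef_param (n a b p d e : int) :
  b != 0 -> a ^+ 2 - n * b ^+ 2 = 1 ->
  p ^+ 2 = b ^+ 2 * d -> 2 * a * p = b ^+ 2 * e ->
  exists k : int, [/\ 2 * p = b ^+ 2 * k, e = a * k & 4 * d = b ^+ 2 * k ^+ 2].
Proof.
move=> b0 pell Ed Ee; exists (a * e - 2 * n * p).
have Ek : 2 * p = b ^+ 2 * (a * e - 2 * n * p).
  transitivity (2 * p * (a ^+ 2 - n * b ^+ 2)); first by rewrite pell mulr1.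
  transitivity (a * (2 * a * p) - 2 * p * n * b ^+ 2); first by ring.
  by rewrite Ee; ring.
have b20 : b ^+ 2 != 0 by rewrite expf_neq0.
split=> //; apply: (mulfI b20).
  by rewrite -Ee [RHS]mulrCA -Ek; ring.
transitivity ((2 * p) ^+ 2); last by rewrite Ek; ring.
by rewrite exprMn Ed; ring.
Qed.

(** The values m / c are the half-integers k / 2 for b even and the integers for
    b odd; in the latter case the evenness of b^2 k^2 forces that of k. *)
Lemma half_pell_c (b d k : int) : 4 * d = b ^+ 2 * k ^+ 2 ->
  exists m : int, (pell_c b)%:~R^-1 * m%:~R = k%:~R / 2 :> rat.
Proof.
rewrite /pell_c => E; case: ifP => b2; first by exists k; rewrite mulrC.
have /dvdzP[m ->] : (2 %| k)%Z.
  have : (2 %| b ^+ 2 * k ^+ 2)%Z.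
    by rewrite -E (_ : 4 * d = 2 * (2 * d)) ?dvdz_mulr //; ring.
  by move: b2; rewrite !dvdzE !abszM !Euclid_dvdM // => ->; case/orP; case/orP.
by exists m; rewrite invr1 mul1r rmorphM /=; field.
Qed.

Lemma ratp_inj : injective ratp.
Proof. by apply: map_inj_poly => //; exact: intr_inj. Qed.

Lemma ratp_linear (p q : int) :
  ratp (p *: 'X + q%:P) = p%:~R *: 'X + (q%:~R)%:P.
Proof. by rewrite /ratp rmorphD /= map_polyZ map_polyX map_polyC. Qed.

Lemma ratp_quadratic (d e q : int) :
  ratp (d *: 'X^2 + e *: 'X + q%:P)
  = d%:~R *: 'X^2 + e%:~R *: 'X + (q%:~R)%:P.
Proof.
by rewrite /ratp !rmorphD /= !map_polyZ map_polyXn map_polyX map_polyC.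
Qed.

Lemma dilate_P0 (a b : int) (t : rat) :
  dilate t (ratp (pell_P0 a b)) = (b%:~R ^+ 2 * t) *: 'X + (a%:~R)%:P.
Proof.
rewrite /dilate /pell_P0 ratp_linear comp_polyD comp_polyZ comp_polyX.
by rewrite comp_polyC scalerA rmorphXn.
Qed.

Lemma dilate_D0 (n a b : int) (t : rat) :
  dilate t (ratp (pell_D0 n a b))
  = (b%:~R ^+ 2 * t ^+ 2) *: 'X^2 + (2 * a%:~R * t) *: 'X + (n%:~R)%:P.
Proof.
rewrite /dilate /pell_D0 ratp_quadratic !comp_polyD !comp_polyZ comp_polyX.
by rewrite comp_polyC comp_Xn_poly exprZn !scalerA rmorphXn rmorphM.
Qed.

Lemma horner0_ratp (P : {poly int}) : (ratp P).[0] = (P.[0])%:~R.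
Proof. by rewrite !horner_coef0 coef_map. Qed.

Theorem proposition2 (n a b : int) (P Q D : {poly int})
    (n_gt0 : 0 < n) (n_nonsquare : ~ perfect_square n)
    (pell : a ^+ 2 - n * b ^+ 2 = 1)
    (degP : size P = 2%N) (degD : size D = 3%N) :
  [/\ P ^+ 2 - D * Q ^+ 2 = 1, P.[0] = a, Q.[0] = b & D.[0] = n]
  <->
  (exists m : int,
     [/\ m != 0,
         ratp P = dilate ((pell_c b)%:~R^-1 * m%:~R) (ratp (pell_P0 a b)),
         Q = b%:P &
         ratp D = dilate ((pell_c b)%:~R^-1 * m%:~R) (ratp (pell_D0 n a b))]).
Proof.
split=> [[E P0 Q0 D0] | [m [m0 EP EQ ED]]].
- have [Qn0 EQ] := pell_const degP degD E; rewrite Q0 in EQ.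
  have b0 : b != 0 by rewrite -polyC_eq0 -EQ.
  have EP := size2_poly degP; have ED := size3_poly degD.
  rewrite P0 in EP; rewrite D0 in ED.
  have p0 : P`_1 != 0.
    have : lead_coef P != 0 by rewrite lead_coef_eq0 -size_poly_eq0 degP.
    by rewrite lead_coefE degP.
  set p := P`_1 in EP p0; set d := D`_2 in ED; set e := D`_1 in ED.
  (* A quadratic identity is settled by three values: 1, -1 and, through [pell],
     0. *)
  have E1 : (p + a) ^+ 2 - (d + e + n) * b ^+ 2 = 1.
    by move: (congr1 (horner^~ 1) E); rewrite EP EQ ED 
      !(hornerD, hornerN, hornerM, horner_exp, hornerZ, hornerX, hornerXn,
        hornerC) => <-; ring.
  have E2 : (a - p) ^+ 2 - (d - e + n) * b ^+ 2 = 1.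
    by move: (congr1 (horner^~ (-1)) E); rewrite EP EQ ED 
      !(hornerD, hornerN, hornerM, horner_exp, hornerZ, hornerX, hornerXn,
        hornerC) => <-; ring.
  have Ed : p ^+ 2 = b ^+ 2 * d by lia.
  have Ee : 2 * a * p = b ^+ 2 * e by lia.
  have [k [Ep Ek Edk]] := pell_coef_param b0 pell Ed Ee.
  have [m Em] := half_pell_c Edk; exists m; rewrite Em; split=> //.
  + apply: contraNneq p0 => m0; move: Em Ep.
    rewrite m0 mulr0 => /esym/eqP; rewrite mulf_eq0 orbC /= intr_eq0.
    by move=> /eqP->; rewrite mulr0 => /eqP; rewrite mulf_eq0.
  + rewrite EP ratp_linear dilate_P0; congr (_ *: _ + _).
    by move/(congr1 (intr : int -> rat)): Ep; rewrite !rmorphM /=; lra.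
  + rewrite ED ratp_quadratic dilate_D0; congr (_ *: _ + _ *: _ + _).
    * move/(congr1 (intr : int -> rat)): Edk.
      by rewrite !rmorphM /=; lra.
    * by rewrite Ek rmorphM /=; field.
- set t := (_ * _ : rat) in EP ED; rewrite dilate_P0 in EP; rewrite dilate_D0 in ED.
  split.
  + apply: ratp_inj; rewrite /ratp rmorphB !rmorphM rmorph1 /=.
    rewrite -/(ratp P) -/(ratp D) EP ED EQ map_polyC /=.
    transitivity ((a ^+ 2 - n * b ^+ 2)%:~R%:P : {poly rat}); last by rewrite pell.
    by rewrite -!mul_polyC !(rmorphM, rmorphB, rmorph_nat) /=; ring.
  + by apply: (@intr_inj rat); rewrite -horner0_ratp EP hornerD hornerZ hornerX
      hornerC mulr0 add0r.
  + by rewrite EQ hornerC.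
  + by apply: (@intr_inj rat); rewrite -horner0_ratp ED !hornerD !hornerZ hornerX
      hornerXn hornerC expr0n !mulr0 !add0r.
Qed.
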